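(* Let $F$ be a field with a nontrivial valuation $v$ and let $O_v$ be the corresponding valuation domain. Let $A \neq F$ be an $F$-algebra having an $O_v$-stable basis over $F$. Then there exists an infinite (strictly) decreasing chain of quasi-valuations on $A$ extending $v$ on $F$. Moreover, for any $O_v$-subalgebra $R$ of $A$ with $R \neq O_v$ lying over $O_v$ (i.e. $R\cap F = O_v$), there exists an infinite (strictly) decreasing chain of quasi-valuations on $RF$ extending $v$ on $F$ starting from $w_R$, where $w_R$ denotes the filter quasi-valuation induced by $(R,v)$.
   Context: Algebras are associative, unital and nonzero, not necessarily commutative, possibly infinite dimensional over $F$; $F$ is identified with $F\cdot 1_A \subseteq A$. $RF$ denotes the $F$-subspace (subalgebra) of $A$ spanned by $R$. $\Gamma_v$ is the value group of $v$. Stable basis: a basis $B$ of $A$ over $F$ is $O_v$-stable if there exists a basis $C$ of $A$ over $F$ such that for all $c \in C$ and $b \in B$ one has $cb \in \sum_{y \in B} O_v y$. Quasi-valuation: a quasi-valuation on a ring $T$ is a function $w: T \to M \cup \{\infty\}$, where $M$ is a totally ordered abelian monoid to which an element $\infty$ greater than all elements of $M$ is adjoined, such that $w(0)=\infty$, $w(xy) \geq w(x)+w(y)$ and $w(x+y) \geq \min\{w(x),w(y)\}$ for all $x,y \in T$. It extends $v$ if $M$ contains $\Gamma_v$ (via an embedding of ordered monoids) and $w(a)=v(a)$ for all $a\in F$. Order on quasi-valuations: two quasi-valuations $w_1,w_2$ on the same ring $T$ are comparable if there is a totally ordered set $M$ with $w_1(T)\cup w_2(T) \subseteq M\cup\{\infty\}$;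 then $w_1 \leq' w_2$ means $w_1(x) \leq w_2(x)$ for all $x \in T$. A decreasing chain of quasi-valuations is with respect to $\leq'$. Cut monoid: a cut of $\Gamma_v$ is a partition $\mathcal A=(\mathcal A^L,\mathcal A^R)$ of $\Gamma_v$ with $\alpha<\beta$ for all $\alpha\in\mathcal A^L$, $\beta\in\mathcal A^R$. The set $\mathcal M(\Gamma_v)$ of all cuts is a totally ordered abelian monoid with $\mathcal A\leq \mathcal B$ iff $\mathcal A^L\subseteq\mathcal B^L$ and $(\mathcal A+\mathcal B)^L=\mathcal A^L+\mathcal B^L$; $\Gamma_v$ embeds by $\alpha \mapsto ((-\infty,\alpha],(\alpha,\infty))$, and $\mathcal B-\alpha$ means $\mathcal B+(-\alpha)$. An element $\infty$ larger than all cuts is adjoined, with $\infty-\alpha=\infty$. Filter quasi-valuation: let $R$ be an $O_v$-subalgebra of $A$ with $R\cap F=O_v$. For $x\in R$ put $S_x=\{a\in O_v \mid xR\subseteq aR\}$. Define $w(0)=\infty$ and, for $0\neq x\in R$, let $w(x)\in\mathcal M(\Gamma_v)$ be the cut with $w(x)^L=\{v(a)\mid a\in S_x\}\cup\{\gamma\in\Gamma_v\mid\gamma<0\}$. One has $w(cx)=v(c)+w(x)$ for $0\neq c\in O_v$, $x\in R$. The filter quasi-valuation $w_R$ on $RF$ induced by $(R,v)$ is given by $w_R(y)=w(cy)-v(c)$ for any $0\neq c\in O_v$ with $cy\in R$; it is known to be a quasi-valuation on $RF$ extending $v$ with $\{y\in RF\mid w_R(y)\geq 0\}=R$. *)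

(* Defs.v *)
From HB Require Import structures.
From mathcomp Require Import all_boot all_order all_algebra.
From mathcomp Require Import boolp classical_sets.

Set Implicit Arguments.
Unset Strict Implicit.
Unset Printing Implicit Defensive.

Import Order.TTheory GRing.Theory Num.Theory.
Local Open Scope classical_set_scope.
Local Open Scope ring_scope.

(* Totally ordered abelian monoids and groups. A Hierarchy Builder structure
   joining [nmodType] and [orderType] cannot be declared, because [ssrnum]
   already joins [zmodType] and [porderType]; hence these plain records, whose
   carriers then receive the library's additive and order structures. *)
Record omonoidType := OMonoidType {
  om_car :> Type;
  om_zero : om_car;
  om_add : om_car -> om_car -> om_car;
  om_le : rel om_car;
  om_addA : associative om_add;
  om_addC : commutative om_add;
  om_add0 : left_id om_zero om_add;
  om_le_refl : reflexive om_le;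
  om_le_anti : antisymmetric om_le;
  om_le_trans : transitive om_le;
  om_le_total : total om_le;
  om_leD2r : forall c a b, om_le a b -> om_le (om_add a c) (om_add b c)
}.

HB.instance Definition _ (M : omonoidType) := gen_eqMixin (om_car M).
HB.instance Definition _ (M : omonoidType) := gen_choiceMixin (om_car M).
HB.instance Definition _ (M : omonoidType) := GRing.isNmodule.Build (om_car M)
  (@om_addA M) (@om_addC M) (@om_add0 M).
HB.instance Definition _ (M : omonoidType) :=
  Order.Le_isPOrder.Build ring_display (om_car M)
    (@om_le_refl M) (@om_le_anti M) (@om_le_trans M).
HB.instance Definition _ (M : omonoidType) :=
  Order.POrder_isTotal.Build ring_display (om_car M) (@om_le_total M).

Lemma lemD2r (M : omonoidType) (c a b : M) : a <= b -> a + c <= b + c.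
Proof. exact: om_leD2r. Qed.

Record ogroupType := OGroupType {
  og_monoid :> omonoidType;
  og_opp : og_monoid -> og_monoid;
  og_addN : left_inverse 0 og_opp +%R
}.

HB.instance Definition _ (G : ogroupType) :=
  GRing.Nmodule_isZmodule.Build (om_car (og_monoid G)) (@og_addN G).

Definition omonoid_embedding (M N : omonoidType) (e : M -> N) : Prop :=
  [/\ e 0 = 0, {morph e : a b / a + b} & {mono e : a b / a <= b}].

(* M together with an element Infty above all elements of M. *)
Inductive adjoin_infty (M : Type) : Type := Fin of M | Infty.
Arguments Infty {M}.

Lemma Fin_inj (M : Type) : injective (@Fin M).
Proof. by move=> a b []. Qed.

Section AdjoinInfty.
Variable M : omonoidType.
Implicit Types x y : adjoin_infty M.

Definition inf_le x y : bool :=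
  match x, y with
  | _, Infty => true
  | Infty, Fin _ => false
  | Fin a, Fin b => a <= b
  end.

Definition inf_add x y : adjoin_infty M :=
  match x, y with
  | Fin a, Fin b => Fin (a + b)
  | _, _ => Infty
  end.

Definition inf_min x y : adjoin_infty M := if inf_le x y then x else y.

End AdjoinInfty.

Definition inf_map (M N : Type) (e : M -> N) (x : adjoin_infty M) :
    adjoin_infty N :=
  match x with Fin a => Fin (e a) | Infty => Infty end.

(* Surjectivity [val_surj] makes G the value group of the valuation, rather
   than an ordered group containing it. *)
Record valuation (F : fieldType) (G : ogroupType) := Valuation {
  val_fun :> F -> adjoin_infty G;
  val_infty : forall a, val_fun a = Infty <-> a = 0;
  valM : forall a b, val_fun (a * b) = inf_add (val_fun a) (val_fun b);
  valD : forall a b,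
    inf_le (inf_min (val_fun a) (val_fun b)) (val_fun (a + b));
  val_surj : forall g, exists a, val_fun a = Fin g
}.

Definition nontrivial_valuation (F : fieldType) (G : ogroupType)
    (v : valuation F G) : Prop :=
  exists2 a, a != 0 & v a <> Fin 0.

Definition val_ring (F : fieldType) (G : ogroupType) (v : valuation F G) :
    set F :=
  [set a | inf_le (Fin 0) (v a)].

(* Combinations of elements of B with coefficients in K; B may be infinite. *)
Definition lin_span (F : fieldType) (A : lmodType F) (K : set F) (B : set A) :
    set A :=
  [set x | exists (n : nat) (c : 'I_n -> F) (b : 'I_n -> A),
     [/\ forall i, K (c i), forall i, B (b i) & x = \sum_(i < n) c i *: b i]].

Definition lin_indep (F : fieldType) (A : lmodType F) (B : set A) : Prop :=
  forall (n : nat) (c : 'I_n -> F) (b : 'I_n -> A),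
    injective b -> (forall i, B (b i)) ->
    \sum_(i < n) c i *: b i = 0 -> forall i, c i = 0.

Definition is_basis (F : fieldType) (A : lmodType F) (B : set A) : Prop :=
  lin_indep B /\ lin_span setT B = setT.

Definition stable_basis (F : fieldType) (G : ogroupType) (v : valuation F G)
    (A : algType F) (B : set A) : Prop :=
  is_basis B /\
  exists2 C : set A, is_basis C &
    forall c b, C c -> B b -> lin_span (val_ring v) B (c * b).

(* Quasi-valuations on a subring T of A: the values of [w] outside T are
   irrelevant. *)
Definition quasi_valuation (A : nzRingType) (T : set A) (M : omonoidType)
    (w : A -> adjoin_infty M) : Prop :=
  [/\ w 0 = Infty,
      forall x y, T x -> T y -> inf_le (inf_add (w x) (w y)) (w (x * y)) &
      forall x y, T x -> T y -> inf_le (inf_min (w x) (w y)) (w (x + y))].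

(* [w] extends [v], the value group being contained in M via [e]. *)
Definition extends_valuation (F : fieldType) (G : ogroupType)
    (v : valuation F G) (A : algType F) (M : omonoidType) (e : G -> M)
    (w : A -> adjoin_infty M) : Prop :=
  omonoid_embedding e /\ forall a : F, w a%:A = inf_map e (v a).

Definition qv_le (A : Type) (T : set A) (M : omonoidType)
    (w1 w2 : A -> adjoin_infty M) : Prop :=
  forall x, T x -> inf_le (w1 x) (w2 x).

Definition qv_lt (A : Type) (T : set A) (M : omonoidType)
    (w1 w2 : A -> adjoin_infty M) : Prop :=
  qv_le T w1 w2 /\ exists2 x, T x & w1 x <> w2 x.

(* The members take their values in one ordered monoid M, with one embedding of
   the value group, so that any two of them are comparable. *)
Definition decreasing_qv_chain (F : fieldType) (G : ogroupType)
    (v : valuation F G) (A : algType F) (T : set A) (M : omonoidType)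
    (e : G -> M) (w : nat -> A -> adjoin_infty M) : Prop :=
  (forall n, quasi_valuation T (w n) /\ extends_valuation v e (w n)) /\
  (forall n, qv_lt T (w n.+1) (w n)).

Section OrderedGroup.
Variable G : ogroupType.
Implicit Types a b c : G.

Lemma leg_D2r c a b : (a + c <= b + c) = (a <= b).
Proof.
apply/idP/idP => [/(lemD2r (- c))|]; last exact: lemD2r.
by rewrite !addrK.
Qed.

Lemma leg_D2l c a b : (c + a <= c + b) = (a <= b).
Proof. by rewrite ![c + _]addrC leg_D2r. Qed.

Lemma leg_BlDr a b c : (a - b <= c) = (a <= c + b).
Proof. by rewrite -(leg_D2r b (a - b)) subrK. Qed.

Lemma leg_D a b c d : a <= b -> c <= d -> a + c <= b + d.
Proof.
by move=> ab cd; apply: le_trans (_ : b + c <= _); rewrite ?leg_D2r ?leg_D2l.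
Qed.

End OrderedGroup.

(* A cut is given by its left part; the right part is the complement. The left
   part may be empty or everything. *)
Record cut (G : ogroupType) := Cut {
  cut_left : set G;
  cut_down : forall a b, a <= b -> cut_left b -> cut_left a
}.

Section CutMonoid.
Variable G : ogroupType.
Implicit Types C D E : cut G.

Lemma cut_eq C D : cut_left C = cut_left D -> C = D.
Proof.
case: C D => [L dL] [K dK] /= LK; subst K.
by congr Cut; exact: Prop_irrelevance.
Qed.

Definition cut_le C D : bool := `[< cut_left C `<=` cut_left D >].

Fact cut_le_refl : reflexive cut_le.
Proof. by move=> C; apply/asboolP. Qed.

Fact cut_le_anti : antisymmetric cut_le.
Proof.
by move=> C D /andP[/asboolP CD /asboolP DC]; apply/cut_eq/seteqP.
Qed.

Fact cut_le_trans : transitive cut_le.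
Proof.
move=> D C E /asboolP CD /asboolP DE; apply/asboolP.
exact: subset_trans CD DE.
Qed.

Fact cut_le_total : total cut_le.
Proof.
move=> C D; case: (boolP (cut_le C D)) => //= /asboolPn nCD.
apply/asboolP => b Db; apply: contrapT => nCb; apply: nCD => a Ca.
have [ab|/ltW ba] := leP a b; first exact: cut_down ab Db.
by case: nCb; exact: cut_down ba Ca.
Qed.

(* The cut ((-oo, g], (g, +oo)). *)
Definition principal_cut (g : G) : cut G :=
  @Cut G [set a | a <= g] (fun a b ab bg => le_trans ab bg).

Definition cut_add_left C D : set G :=
  [set a + b | a in cut_left C & b in cut_left D].

Fact cut_add_down C D a b :
  a <= b -> cut_add_left C D b -> cut_add_left C D a.
Proof.
move=> ab [c Cc [d Dd cdb]]; exists (a - d); last by exists d; rewrite ?subrK.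
by apply: (cut_down _ Cc); rewrite leg_BlDr cdb.
Qed.

Definition cut_add C D : cut G := Cut (@cut_add_down C D).

Fact cut_addA : associative cut_add.
Proof.
move=> C D E; apply/cut_eq/seteqP; split=> g /=.
  case=> a Ca [u [b Db [c Ec uE]] gE]; subst u g.
  by exists (a + b); [exists a => //; exists b | exists c; rewrite ?addrA].
case=> u [a Ca [b Db uE]] [c Ec gE]; subst u g.
by exists a => //; exists (b + c); [exists b => //; exists c | rewrite addrA].
Qed.

Fact cut_addC : commutative cut_add.
Proof.
move=> C D; apply/cut_eq/seteqP.
by split=> _ [a Ca [b Db <-]]; exists b => //; exists a; rewrite // addrC.
Qed.

Fact cut_add0 : left_id (principal_cut 0) cut_add.
Proof.
move=> C; apply/cut_eq/seteqP; split=> [_ [a /= a0 [b Cb <-]]|b Cb].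
  by apply: (cut_down _ Cb); rewrite -[leRHS]add0r leg_D2r.
by exists 0; [exact: lexx | exists b; rewrite ?add0r].
Qed.

Fact cut_leD2r E C D : cut_le C D -> cut_le (cut_add C E) (cut_add D E).
Proof.
move=> /asboolP CD; apply/asboolP => _ [a Ca [b Eb <-]].
by exists a; [exact: CD | exists b].
Qed.

Definition cut_monoid : omonoidType := OMonoidType
  cut_addA cut_addC cut_add0
  cut_le_refl cut_le_anti cut_le_trans cut_le_total cut_leD2r.

Definition cut_embed (g : G) : cut_monoid := principal_cut g.

Lemma cut_embed_embedding : omonoid_embedding cut_embed.
Proof.
split=> // [a b|a b].
  apply/cut_eq/seteqP; split=> [c /= cab|_ [c /= ca [d /= db <-]]].
    exists (c - b); first by rewrite /= leg_BlDr.
    by exists b; [exact: lexx | rewrite subrK].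
  exact: leg_D.
apply/asboolP/idP => [/(_ a)|ab c /= ca]; first by apply; exact: lexx.
exact: le_trans ca ab.
Qed.

Definition inf_cut_sub (C : adjoin_infty cut_monoid) (g : G) :
    adjoin_infty cut_monoid :=
  inf_add C (Fin (cut_embed (- g))).

End CutMonoid.

(* [sub_over] states R \cap F = O_v; as 1 \in R, stability under O_v-scaling
   already puts O_v inside R. *)
Record lying_over_subalg (F : fieldType) (G : ogroupType) (v : valuation F G)
    (A : algType F) := LyingOverSubalg {
  sub_set :> A -> Prop;
  sub_1 : sub_set 1;
  sub_B : forall x y, sub_set x -> sub_set y -> sub_set (x - y);
  sub_M : forall x y, sub_set x -> sub_set y -> sub_set (x * y);
  sub_Z : forall a x, val_ring v a -> sub_set x -> sub_set (a *: x);
  sub_over : forall a : F, sub_set a%:A <-> val_ring v a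
}.

Section Valuation.
Variables (F : fieldType) (G : ogroupType) (v : valuation F G).
Implicit Types (a b c : F) (g h : G).

Lemma val_neq0 a : a != 0 -> exists g, v a = Fin g.
Proof.
case E : (v a) => [g|] => [_|/eqP a0]; first by exists g.
by case: a0; apply/(val_infty v a).
Qed.

Lemma fin_neq0 a g : v a = Fin g -> a != 0.
Proof.
by move=> vag; apply/eqP => /(val_infty v a); rewrite vag.
Qed.

Lemma val1 : v 1 = Fin 0.
Proof.
have [g vg] := val_neq0 (oner_neq0 F); have := valM v 1 1.
rewrite mulr1 vg /= => -[/eqP]; rewrite -subr_eq0 opprD addrA subrr add0r.
by rewrite oppr_eq0 => /eqP->.
Qed.

Lemma valM_fin a b g h : v a = Fin g -> v b = Fin h -> v (a * b) = Fin (g + h).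
Proof. by move=> vg vh; rewrite valM vg vh. Qed.

Lemma val_div a b g h : v a = Fin g -> v b = Fin h -> v (a / b) = Fin (g - h).
Proof.
move=> vg vh; have b0 := fin_neq0 vh; have a0 := fin_neq0 vg.
have [|k vk] := @val_neq0 (a / b); first by rewrite mulf_neq0 ?invr_neq0.
by have := valM_fin vk vh; rewrite divfK // vg vk => -[->]; rewrite addrK.
Qed.

Lemma val_ring_fin a g : v a = Fin g -> val_ring v a <-> 0 <= g.
Proof. by move=> vg; rewrite /val_ring /= vg. Qed.

End Valuation.

Section FilterQuasiValuation.
Variables (F : fieldType) (G : ogroupType) (v : valuation F G).
Variables (A : algType F) (R : lying_over_subalg v A).
Implicit Types (a b c : F) (x y : A) (g : G).

(* S_x, for x in R. *)
Definition divisor_set x : set F :=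
  [set a | val_ring v a /\
           [set x * r | r in sub_set R] `<=` [set a *: r | r in sub_set R]].

Definition filter_left x : set G :=
  [set g | (exists2 a, divisor_set x a & v a = Fin g) \/ g < 0].

Fact filter_left_down x g h :
  g <= h -> filter_left x h -> filter_left x g.
Proof.
move=> gh [[a [Oa xa] vah]|h0]; last by right; exact: le_lt_trans h0.
have [g0|g0] := ltP g 0; [by right | left].
have [b vbg] := val_surj v g; exists b => //; split.
  exact/(val_ring_fin vbg).
move=> y /xa [r Rr <-]; exists ((a / b) *: r).
  apply: sub_Z => //; apply/(val_ring_fin (val_div vah vbg)).
  by rewrite -(leg_D2r g) add0r subrK.
by rewrite scalerA mulrC divfK // (fin_neq0 vbg).
Qed.

(* The map w on R used to define w_R; meaningful for x in R only. *)
Definition filter_val x : adjoin_infty (cut_monoid G) :=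
  if x == 0 then Infty else Fin (Cut (@filter_left_down x)).

Definition scaling_set y : set F :=
  [set c | [/\ c != 0, val_ring v c & R (c *: y)]].

(* w_R, meaningful on RF. The value does not depend on the choice of c, see
   [filter_qvE]. *)
Definition filter_qv y : adjoin_infty (cut_monoid G) :=
  let c := xget 1 (scaling_set y) in
  match v c with
  | Fin g => inf_cut_sub (filter_val (c *: y)) g
  | Infty => Infty
  end.

Lemma filter_valZ c g x : R x -> v c = Fin g -> 0 <= g ->
  filter_val (c *: x) = inf_add (Fin (cut_embed g)) (filter_val x).
Proof.
move=> Rx vc g0; have c0 := fin_neq0 vc.
rewrite /filter_val scaler_eq0 (negbTE c0) /=.
case: ifP => // _; rewrite /inf_add; congr Fin; apply/cut_eq/seteqP.
have zx : filter_left x 0.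
  left; exists 1; last exact: val1.
  split; first by apply/(val_ring_fin (val1 v)).
  by move=> _ [r Rr <-]; exists (x * r); rewrite ?scale1r //; apply: sub_M.
have below h : h <= g -> cut_add_left (principal_cut g)
    (Cut (@filter_left_down x)) h.
  by move=> hg; exists h => //; exists 0; rewrite ?addr0.
split=> [h /= [[a [Oa xa] va]|h0]|_ /= [h /= hg [k xk <-]]].
- have [/below//|/ltW gh] := leP h g.
  exists g; first exact: lexx.
  exists (h - g); last by rewrite addrC subrK.
  left; exists (a / c); last exact: val_div.
  split.
    by apply/(val_ring_fin (val_div va vc)); rewrite -(leg_D2r g) add0r subrK.
  move=> _ [r Rr <-]; have [|s Rs e] := xa (c *: x * r); first by exists r.
  exists s => //; apply: (scalerI c0).
  by rewrite scalerA mulrC divfK // e scalerAl.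
- by apply: below; exact: le_trans (ltW h0) g0.
- apply: filter_left_down (_ : filter_left (c *: x) (g + k)).
    by rewrite leg_D2r.
  case: xk => [[a [Oa xa] va]|k0].
    left; exists (c * a); last exact: valM_fin.
    split.
      apply/(val_ring_fin (valM_fin vc va)); rewrite -[0]addr0.
      by apply: leg_D => //; apply/(val_ring_fin va).
    move=> _ [r Rr <-]; have [|s Rs e] := xa (x * r); first by exists r.
    by exists s => //; rewrite -scalerA e scalerAl.
  have [l0|l0] := ltP (g + k) 0; [by right | left].
  have [b vb] := val_surj v (g + k); exists b => //; split.
    exact/(val_ring_fin vb).
  move=> _ [r Rr <-]; exists ((c / b) *: (x * r)).
    apply: sub_Z; last exact: sub_M.
    apply/(val_ring_fin (val_div vc vb)).
    by rewrite -(leg_D2r (g + k)) add0r subrK -[leRHS]addr0 leg_D2l ltW.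
  by rewrite scalerA mulrC divfK ?(fin_neq0 vb) // scalerAl.
Qed.

Lemma filter_qvE y c g : scaling_set y c -> v c = Fin g ->
  filter_qv y = inf_cut_sub (filter_val (c *: y)) g.
Proof.
move=> Sc vc; rewrite /filter_qv.
have := xgetPex 1 (ex_intro _ c Sc); set d := xget _ _ => -[d0 Od Rd].
case: Sc => c0 Oc Rc; have [h vd] := val_neq0 v d0; rewrite vd.
have g0 : 0 <= g by apply/(val_ring_fin vc).
have h0 : 0 <= h by apply/(val_ring_fin vd).
have := filter_valZ Rd vc g0; rewrite scalerA mulrC -scalerA.
rewrite (filter_valZ Rc vd h0).
have [_ pD _] := cut_embed_embedding G.
case: (filter_val (c *: y)) (filter_val (d *: y)) => [C|] [D|] // E; have e := Fin_inj E.
have p0 (k : G) : cut_embed k + cut_embed (- k) = 0.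
  by rewrite -pD subrr.
congr Fin; rewrite -[LHS]add0r -(p0 g) addrACA -e [cut_embed (- g) + _]addrC.
by rewrite addrACA p0 add0r.
Qed.

End FilterQuasiValuation.

(* Main.v *)
Require Import Defs.
From mathcomp Require Import all_boot all_order all_algebra.
From mathcomp Require Import boolp classical_sets.

Set Implicit Arguments.
Unset Strict Implicit.
Unset Printing Implicit Defensive.

Import Order.TTheory GRing.Theory Num.Theory.
Local Open Scope classical_set_scope.
Local Open Scope ring_scope.

(* For a subalgebra R lying over O_v put w_R(x) = sup {v(a) | x in aR}; this is
   the filter quasi-valuation, and it is increasing in R, strictly so for
   strict inclusions. It therefore suffices to find a strictly decreasing
   sequence of subalgebras starting from R. A stable basis B provides one
   subalgebra S = {x | xL <= L}, with L the O_v-span of B, which spans A and in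
   which no y outside F is infinitely divisible modulo F: for some z <> 0,
   y in F + aS implies that a divides z. Fix such a y in both R and S, and d in
   O_v not dividing z. The subalgebras R_0 = R and R_n = R /\ (O_v + d^n S),
   n > 0, decrease, and d^n y lies in R_n but not in R_(n+1). The first claim is
   the case R = S. *)

(** * Arithmetic of the valuation ring *)

Section ValuationRing.
Variables (F : fieldType) (G : ogroupType) (v : valuation F G).
Implicit Types a b z : F.

Lemma val_ring0 : val_ring v 0.
Proof. by rewrite /val_ring /= (_ : v 0 = Infty) //; apply/val_infty. Qed.

Lemma val_ring1 : val_ring v 1.
Proof. by apply/(val_ring_fin (Defs.val1 v)). Qed.

Lemma val_ringM a b : val_ring v a -> val_ring v b -> val_ring v (a * b).
Proof.
rewrite /val_ring /= Defs.valM; case: (v a) (v b) => [g|] [h|] //= g0 h0.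
by rewrite -[0]addr0; apply: leg_D.
Qed.

Lemma val_ringD a b : val_ring v a -> val_ring v b -> val_ring v (a + b).
Proof.
rewrite /val_ring /=; have := valD v a b; rewrite /inf_min.
case: (v a) (v b) (v (a + b)) => [g|] [h|] [k|] //=.
- by case: ifP => _ /= k1 g0 h0; apply: le_trans k1.
- by move=> gk g0 _; apply: le_trans gk.
- by move=> hk _ h0; apply: le_trans hk.
Qed.

Lemma val_ringVn a : ~ val_ring v a -> val_ring v a^-1.
Proof.
move=> na; have [a0|a0] := eqVneq a 0.
  by case: na; rewrite a0; exact: val_ring0.
have [g vg] := val_neq0 v a0.
have := val_div (Defs.val1 v) vg; rewrite div1r => vV.
apply/(val_ring_fin vV); rewrite sub0r -(leg_D2r g) add0r addNr ltW // ltNge.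
by apply/negP => /(val_ring_fin vg).
Qed.

Lemma val_ringN a : val_ring v a -> val_ring v (- a).
Proof.
rewrite -mulN1r => /(val_ringM _); apply.
(* A valuation ring contains every element or its inverse, and -1 is its own inverse. *)
case: (pselect (val_ring v (-1))) => // /val_ringVn.
by rewrite invrN invr1.
Qed.

Lemma val_ringB a b : val_ring v a -> val_ring v b -> val_ring v (a - b).
Proof. by move=> va vb; apply: val_ringD => //; apply: val_ringN. Qed.

Lemma val_ringX a n : val_ring v a -> val_ring v (a ^+ n).
Proof.
move=> va; elim: n => [|n IH]; first exact: val_ring1.
by rewrite exprS; apply: val_ringM.
Qed.

Lemma val_ring_div a b g h : v a = Fin g -> v b = Fin h ->
  val_ring v (a / b) <-> h <= g.
Proof.
move=> va vb; have /val_ring_fin -> := val_div va vb.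
by rewrite -(leg_D2r h 0) add0r subrK.
Qed.

Lemma exists_large_val z : nontrivial_valuation v -> z != 0 ->
  exists d, [/\ d != 0, val_ring v d & ~ val_ring v (z / d)].
Proof.
move=> [a a0 va] z0.
have [g vg] := val_neq0 v z0; have [k vk] := val_neq0 v a0.
have [e e0] : exists e : G, 0 < e.
  have k0 : k != 0 by apply/eqP => k0; apply: va; rewrite vk k0.
  case: (ltgtP k 0) k0 => // [kneg|kpos] _; last by exists k.
  by exists (- k); rewrite ltNge -(leg_D2r k) addNr add0r -ltNge.
(* This value exceeds 0, so [d] lies in [O_v], and exceeds [v z], so [d] does not divide [z]. *)
have [d vd] := val_surj v (Order.max g 0 + e).
have m0 : Order.max g 0 < Order.max g 0 + e.
  by rewrite ltNge -[leRHS]addr0 leg_D2l -ltNge.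
exists d; split; first exact: fin_neq0 vd.
  by apply/(val_ring_fin vd)/ltW/(le_lt_trans _ m0); rewrite le_max lexx orbT.
move=> /(val_ring_div vg vd); apply/negP; rewrite -ltNge.
by apply: le_lt_trans m0; rewrite le_max lexx.
Qed.

(** Induction on the number of terms: either a coefficient or its inverse lies in [O_v], so each one
    can be cleared by a nonzero element of [O_v]. *)
Lemma common_denominator (A : lmodType F) (P : set A) (x : A) :
  P 0 -> (forall y y1, P y -> P y1 -> P (y + y1)) ->
  (forall a y, val_ring v a -> P y -> P (a *: y)) ->
  lin_span setT P x -> exists c, [/\ c != 0, val_ring v c & P (c *: x)].
Proof.
move=> P0 PD PZ [n [c [b [_ Pb ->]]]].
elim: n c b Pb => [|n IH] c b Pb.
  by exists 1; rewrite big_ord0 scaler0 oner_neq0; split=> //; exact: val_ring1.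
rewrite big_ord_recl.
have [d [d0 Od Pd]] := IH (c \o lift ord0) (b \o lift ord0) (fun i => Pb _).
have [u [u0 Ou Ouc]] :
    exists u, [/\ u != 0, val_ring v u & val_ring v (u * c ord0)].
  case: (pselect (val_ring v (c ord0))) => [Oc|nOc].
    by exists 1; rewrite mul1r oner_neq0; split=> //; exact: val_ring1.
  have c0 : c ord0 != 0.
    by apply/eqP => c0; apply: nOc; rewrite c0; exact: val_ring0.
  exists (c ord0)^-1; rewrite invr_neq0 ?mulVf //.
  by split=> //; [exact: val_ringVn | exact: val_ring1].
exists (u * d); split; [exact: mulf_neq0 | exact: val_ringM |].
rewrite scalerDr; apply: PD; last by rewrite -scalerA; apply: PZ.
by rewrite scalerA mulrAC; apply: PZ => //; exact: val_ringM.
Qed.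

End ValuationRing.

(** * The quasi-valuation attached to a subalgebra, defined on all of [A] *)

Section Gauge.
Variables (F : fieldType) (G : ogroupType) (v : valuation F G) (A : algType F).
Implicit Types (R : lying_over_subalg v A) (x y : A).

Lemma sub_0 R : R 0.
Proof. by rewrite -(subrr 1); apply: sub_B; exact: sub_1. Qed.

Lemma sub_D R x y : R x -> R y -> R (x + y).
Proof.
move=> Rx Ry; rewrite -[y]opprK; apply: sub_B => //.
by rewrite -sub0r; apply: sub_B => //; exact: sub_0.
Qed.

(** A finite value makes [a] nonzero, so the condition is that x lies in aR. The choice of [a] is
    immaterial: elements of equal value differ by a unit of [O_v]. *)
Definition gauge_left R x : set G :=
  [set g | exists2 a, v a = Fin g & R (a^-1 *: x)].

Fact gauge_left_down R x g h : g <= h -> gauge_left R x h -> gauge_left R x g.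
Proof.
move=> gh [a va Rx]; have [b vb] := val_surj v g; exists b => //.
have -> : b^-1 *: x = (a / b) *: (a^-1 *: x).
  by rewrite scalerA mulrAC divff ?mul1r // (fin_neq0 va).
by apply: sub_Z => //; apply/(val_ring_div va vb).
Qed.

(* The supremum of the v(a) with x in aR. It makes sense on all of A: outside
   RF its value is the cut with empty left part. *)
Definition gauge R x : adjoin_infty (cut_monoid G) :=
  if x == 0 then Infty else Fin (Cut (@gauge_left_down R x)).

Lemma gauge0 R : gauge R 0 = Infty.
Proof. by rewrite /gauge eqxx. Qed.

Lemma gauge_left0 R x : gauge_left R x 0 <-> R x.
Proof.
split=> [[a va Rx]|Rx]; last first.
  by exists 1; [exact: Defs.val1 | rewrite invr1 scale1r].
have -> : x = a *: (a^-1 *: x) by rewrite scalerA divff ?scale1r ?(fin_neq0 va).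
by apply: sub_Z => //; apply/(val_ring_fin va).
Qed.

Lemma gauge_leftZ R x c g h : v c = Fin g ->
  gauge_left R (c *: x) h <-> gauge_left R x (h - g).
Proof.
move=> vc; have c0 := fin_neq0 vc; split=> -[a va Rx].
  exists (a / c); first exact: val_div.
  by rewrite invf_div mulrC -scalerA.
exists (a * c); first by rewrite (valM_fin va vc) subrK.
by rewrite scalerA invfM -mulrA mulVf // mulr1.
Qed.

Lemma gauge_leftM R x y g h :
  gauge_left R x g -> gauge_left R y h -> gauge_left R (x * y) (g + h).
Proof.
move=> [a va Rx] [b vb Ry]; exists (a * b); first exact: valM_fin.
rewrite invfM -scalerA scalerAr scalerAl; exact: sub_M.
Qed.

Lemma gauge_leftD R x y g :
  gauge_left R x g -> gauge_left R y g -> gauge_left R (x + y) g.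
Proof.
have [a va] := val_surj v g; rewrite -(add0r g) -(addrK g (0 + g)).
(* The two summands may come with different witnesses of value [g]; [E] replaces both by the fixed
   [a]. The padded form of [g] is only there to match the rewritten goal. *)
have E z : gauge_left R z (0 + g + g - g) <-> R (a^-1 *: z).
  rewrite addrK -(gauge_left0 R (a^-1 *: z)).
  have := val_div (Defs.val1 v) va; rewrite div1r => /gauge_leftZ ->.
  by rewrite !sub0r opprK add0r.
by rewrite !E scalerDr; exact: sub_D.
Qed.

Lemma gauge_qv R : quasi_valuation [set: A] (gauge R).
Proof.
split=> [|x y _ _|x y _ _]; first exact: gauge0.
  rewrite /gauge; have [->|x0] := eqVneq x 0; first by rewrite mul0r eqxx.
  have [->|y0] := eqVneq y 0; first by rewrite mulr0 eqxx.
  case: ifP => // _; apply/asboolP => _ [g xg [h yh <-]].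
  exact: gauge_leftM.
have [->|x0] := eqVneq x 0.
  rewrite add0r gauge0; case: (gauge R y) => //= C; exact: lexx.
have [->|y0] := eqVneq y 0.
  rewrite addr0 gauge0; case: (gauge R x) => //= C; exact: lexx.
rewrite /inf_min /gauge (negbTE x0) (negbTE y0).
have [//|_] := eqVneq (x + y) 0; first by case: ifP.
case: ifPn => /= [/asboolP xy|].
  by apply/asboolP => g xg; apply: gauge_leftD => //; exact: xy.
rewrite -ltNge => /ltW/asboolP yx.
by apply/asboolP => g yg; apply: gauge_leftD => //; exact: yx.
Qed.

(** Since R meets F exactly in [O_v], a/b lies in R iff v(b) <= v(a), which makes the cut
    principal. *)
Lemma gauge_scalar R a : gauge R a%:A = inf_map (@cut_embed G) (v a).
Proof.
rewrite /gauge scaler_eq0 oner_eq0 orbF; have [->|a0] := eqVneq a 0.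
  by rewrite (_ : v 0 = Infty) //; apply/val_infty.
have [g va] := val_neq0 v a0; rewrite va /=; congr Fin.
apply/cut_eq/seteqP; split=> h /=.
  move=> /(gauge_leftZ R 1 h va) [b vb /sub_over Ob].
  have := val_div (Defs.val1 v) vb; rewrite div1r => /val_ring_fin/iffLR/(_ Ob).
  by rewrite sub0r -(leg_D2r (h - g) 0) addNr add0r leg_BlDr add0r.
move=> hg; apply/(gauge_leftZ R 1 h va).
apply: gauge_left_down (_ : gauge_left R 1 0); first by rewrite leg_BlDr add0r.
by apply/gauge_left0; exact: sub_1.
Qed.

Lemma gauge_le R R' x :
  sub_set R' `<=` sub_set R -> inf_le (gauge R' x) (gauge R x).
Proof.
move=> RR; rewrite /gauge; case: ifP => // _; apply/asboolP => g [a va Rx].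
by exists a => //; exact: RR.
Qed.

(** A subalgebra is recovered from its gauge: by [gauge_left0], its nonzero elements are those whose
    cut contains 0. *)
Lemma gauge_neq R R' x : R x -> ~ R' x -> gauge R' x <> gauge R x.
Proof.
move=> Rx nRx; rewrite /gauge; case: eqP => [x0|_].
  by case: nRx; rewrite x0; exact: sub_0.
move=> E0; have /= E := congr1 (fun C : cut G => cut_left C 0) (Fin_inj E0).
by apply: nRx; apply/gauge_left0; rewrite E; apply/gauge_left0.
Qed.

(** As 1 is in R, the inclusion of xR in aR amounts to x in aR. The negative values adjoined by the
    filter construction are already present, because x in R puts 0 in the cut. *)
Lemma filter_left_gauge R x g : R x -> filter_left R x g <-> gauge_left R x g.
Proof.
move=> Rx; split=> [[[a [Oa xa] va]|g0]|[a va Ra]].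
- exists a => //; have [|r Rr /(congr1 (fun y => a^-1 *: y))] := xa x.
    by exists 1; rewrite ?mulr1 //; exact: sub_1.
  by rewrite scalerA mulVf ?(fin_neq0 va) // scale1r => <-.
- by apply: gauge_left_down (ltW g0) _; apply/gauge_left0.
have [g0|g0] := ltP g 0; [by right | left; exists a => //; split].
  by apply/(val_ring_fin va).
move=> _ [r Rr <-]; exists (a^-1 *: x * r); first exact: sub_M.
by rewrite -scalerAl scalerA divff ?scale1r // (fin_neq0 va).
Qed.

(** Scaling by a denominator [c] of [y] brings it into R, where the two cuts agree; subtracting v(c)
    undoes the shift. *)
Lemma filter_qv_gauge R y :
  lin_span [set: F] (sub_set R) y -> filter_qv R y = gauge R y.
Proof.
move=> /(common_denominator (sub_0 R) (@sub_D R) (@sub_Z _ _ _ _ R))[c Sc].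
have [c0 _ Rc] := Sc; have [g vc] := val_neq0 v c0.
rewrite (filter_qvE Sc vc) /filter_val /gauge scaler_eq0 (negbTE c0) /=.
case: ifP => // _; congr Fin.
apply/cut_eq/seteqP; split=> [_ [h xh [k kg <-]]|h yh].
  apply: gauge_left_down (_ : gauge_left R y (h - g)); first by rewrite leg_D2l.
  by apply/(gauge_leftZ R y h vc)/filter_left_gauge.
exists (h + g); last by exists (- g); [exact: lexx | rewrite addrK].
by apply/filter_left_gauge => //; apply/(gauge_leftZ R y _ vc); rewrite addrK.
Qed.

End Gauge.

(** * Coordinates with respect to a possibly infinite basis *)

Section Coordinates.
Variables (F : fieldType) (A : lmodType F) (B : set A) (basisB : is_basis B).
Implicit Types (s : seq (F * A)) (e x y : A) (a : F).

(** Lists of pairs may repeat basis vectors, so that sums of combinations are concatenations; [coef]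
    collects the repetitions. *)
Let lcomb s : A := \sum_(p <- s) p.1 *: p.2.
Let coef e s : F := \sum_(p <- s | p.2 == e) p.1.
Let over s : Prop := forall p, p \in s -> B p.2.

Lemma lcomb_coef s :
  lcomb s = \sum_(e <- undup [seq p.2 | p <- s]) coef e s *: e.
Proof.
under eq_bigr do rewrite scaler_suml.
rewrite (exchange_big_dep predT) //= /lcomb big_seq [RHS]big_seq.
apply: eq_bigr => p sp.
under eq_bigl do rewrite eq_sym.
rewrite -big_filter filter_pred1_uniq ?undup_uniq ?mem_undup ?map_f //.
by rewrite big_seq1.
Qed.

(** [lin_indep] speaks of injective families only, so repeated vectors are first merged by
    [lcomb_coef]. *)
Lemma coef_eq0 s e : over s -> lcomb s = 0 -> coef e s = 0.
Proof.
rewrite lcomb_coef => sB; set u := undup _ => s0.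
have [eu|eu] := boolP (e \in u); last first.
  rewrite /coef big_seq_cond big_pred0 // => p.
  apply/negbTE/negP => /andP[sp /eqP pe].
  by case/negP: eu; rewrite mem_undup -pe map_f.
have ltu : (index e u < size u)%N by rewrite index_mem.
have := @basisB.1 (size u) (fun i => coef (nth 0 u i) s) (fun i => nth 0 u i).
move=> /(_ _ _ _ (Ordinal ltu)) /=; rewrite nth_index //; apply.
- by move=> i j /eqP; rewrite nth_uniq ?undup_uniq // => /eqP /val_inj.
- move=> i; have: nth 0 u i \in u by exact: mem_nth.
  by rewrite mem_undup => /mapP[p /sB Bp ->].
- by rewrite -[RHS]s0 (big_nth 0) big_mkord.
Qed.

(** Reads the coefficient off some chosen combination equal to [x]; [coord_lcomb] shows independence
    of the choice. *)
Definition coord e x : F := coef e (xget [::] [set s | over s /\ lcomb s = x]).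

Lemma span_lcomb (K : set F) x : lin_span K B x ->
  exists s, [/\ over s, lcomb s = x & forall p, p \in s -> K p.1].
Proof.
move=> [n [c [b [Kc Bb ->]]]]; exists [seq (c i, b i) | i <- enum 'I_n]; split.
- by move=> ? /mapP[i _ -> /=].
- by rewrite /lcomb big_map big_enum.
- by move=> ? /mapP[i _ -> /=].
Qed.

Lemma coord_lcomb e s : over s -> coord e (lcomb s) = coef e s.
Proof.
move=> sB; rewrite /coord; set t := xget _ _.
have [tB tE] : over t /\ lcomb t = lcomb s.
  apply: (@xgetPex _ [::] [set s' | over s' /\ lcomb s' = lcomb s]).
  by exists s.
apply/eqP; rewrite -subr_eq0; apply/eqP.
(* The formal difference of the two combinations, which represents 0. *)
pose r := t ++ [seq (- p.1, p.2) | p <- s].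
have <- : coef e r = coef e t - coef e s.
  by rewrite /coef big_cat big_map /= sumrN.
apply: coef_eq0 => [p|].
  by rewrite mem_cat => /orP[/tB//|/mapP[q /sB Bq ->]].
rewrite /lcomb big_cat big_map /= -/(lcomb t) tE.
by under eq_bigr do rewrite scaleNr; rewrite sumrN subrr.
Qed.

Lemma basis_lcomb x : exists2 s, over s & lcomb s = x.
Proof.
have : lin_span setT B x by rewrite basisB.2.
by move=> /span_lcomb[s [sB sE _]]; exists s.
Qed.

Lemma coordD e x y : coord e (x + y) = coord e x + coord e y.
Proof.
have [s sB <-] := basis_lcomb x; have [t tB <-] := basis_lcomb y.
rewrite -[lcomb s + _]big_cat !coord_lcomb // /coef ?big_cat // => p.
by rewrite mem_cat => /orP[/sB|/tB].
Qed.

Lemma coordZ e a x : coord e (a *: x) = a * coord e x.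
Proof.
have [s sB <-] := basis_lcomb x.
have <- : lcomb [seq (a * p.1, p.2) | p <- s] = a *: lcomb s.
  rewrite /lcomb big_map scaler_sumr; apply: eq_bigr => p _.
  by rewrite scalerA.
rewrite !coord_lcomb //; first by rewrite /coef big_map mulr_sumr.
by move=> ? /mapP[p /sB Bp ->].
Qed.

Lemma coord0 e : coord e 0 = 0.
Proof. by rewrite -(scale0r 0) coordZ mul0r. Qed.

Lemma coordB e x y : coord e (x - y) = coord e x - coord e y.
Proof. by rewrite -scaleN1r coordD coordZ mulN1r. Qed.

Lemma coord_basis e e' : B e' -> coord e e' = (e' == e)%:R.
Proof.
move=> Be'; have -> : e' = lcomb [:: (1, e')].
  by rewrite /lcomb big_seq1 scale1r.
rewrite coord_lcomb; last by move=> p; rewrite inE => /eqP ->.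
by rewrite /coef big_mkcond big_seq1 /lcomb big_seq1 scale1r; case: eqP.
Qed.

Lemma coord_expansion x :
  exists s : seq A,
    (forall e, e \in s -> B e) /\ x = \sum_(e <- s) coord e x *: e.
Proof.
have [s sB <-] := basis_lcomb x; exists (undup [seq p.2 | p <- s]); split.
  by move=> e; rewrite mem_undup => /mapP[p /sB Bp ->].
by rewrite {1}lcomb_coef; apply: eq_bigr => e _; rewrite coord_lcomb.
Qed.

Lemma coord_inj x y : (forall e, coord e x = coord e y) -> x = y.
Proof.
move=> E; apply/eqP; rewrite -subr_eq0; apply/eqP.
have [s [_ ->]] := coord_expansion (x - y).
by rewrite big1 // => e _; rewrite coordB E subrr scale0r.
Qed.

Lemma coord_closed (K : set F) e x : K 0 ->
  (forall a b, K a -> K b -> K (a + b)) -> lin_span K B x -> K (coord e x).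
Proof.
move=> K0 KD /span_lcomb[s [sB <- sK]].
rewrite coord_lcomb // /coef big_seq_cond.
by apply: big_ind => // p /andP[/sK].
Qed.

End Coordinates.

(** * The multiplier ring of the lattice spanned by a stable basis *)

Section Multiplier.
Variables (F : fieldType) (G : ogroupType) (v : valuation F G) (A : algType F).
Variables (B C : set A) (basisB : is_basis B) (basisC : is_basis C).
Hypothesis stableBC :
  forall c b, C c -> B b -> lin_span (val_ring v) B (c * b).
Implicit Types (x y e : A) (a : F).

(** The [O_v]-span of [B], in coordinates so that closure properties are checked coordinatewise. *)
Let lattice : set A := [set x | forall e, val_ring v (coord B e x)].

Let latticeD x y : lattice x -> lattice y -> lattice (x + y).
Proof. by move=> Lx Ly e; rewrite coordD //; exact: val_ringD. Qed.

Let latticeZ a x : val_ring v a -> lattice x -> lattice (a *: x).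
Proof. by move=> Oa Lx e; rewrite coordZ //; exact: val_ringM. Qed.

Let lattice0 : lattice 0.
Proof. by move=> e; rewrite coord0 //; exact: val_ring0. Qed.

Let lattice_basis e : B e -> lattice e.
Proof.
move=> Be e'; rewrite coord_basis //.
by case: eqP => _; [exact: val_ring1 | exact: val_ring0].
Qed.

Lemma basis_neq0 : exists e, B e.
Proof.
have [s [sB E]] := coord_expansion basisB (1 : A).
case: s sB E => [_ /eqP|e s sB _]; first by rewrite big_nil oner_eq0.
by exists e; apply: sB; rewrite mem_head.
Qed.

Definition multiplier : set A :=
  [set x | forall y, lattice y -> lattice (x * y)].

Fact multiplier1 : multiplier 1.
Proof. by move=> y; rewrite mul1r. Qed.

Fact multiplierB x y : multiplier x -> multiplier y -> multiplier (x - y).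
Proof.
move=> Sx Sy z Lz; rewrite mulrBl -scaleN1r; apply: latticeD; first exact: Sx.
by apply: latticeZ; [apply: val_ringN; exact: val_ring1 | exact: Sy].
Qed.

Fact multiplierM x y : multiplier x -> multiplier y -> multiplier (x * y).
Proof. by move=> Sx Sy z Lz; rewrite -mulrA; apply/Sx/Sy. Qed.

Fact multiplierZ a x : val_ring v a -> multiplier x -> multiplier (a *: x).
Proof. by move=> Oa Sx z Lz; rewrite -scalerAl; apply/latticeZ/Sx. Qed.

(** A scalar acting on a basis vector appears as a coordinate of the image. *)
Fact multiplier_over a : multiplier a%:A <-> val_ring v a.
Proof.
split=> [Sa|Oa]; last by apply: multiplierZ => //; exact: multiplier1.
have [e Be] := basis_neq0; have := Sa e (lattice_basis Be) e.
by rewrite -scalerAl mul1r coordZ // coord_basis // eqxx mulr1.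
Qed.

Definition multiplier_subalg : lying_over_subalg v A := LyingOverSubalg
  multiplier1 multiplierB multiplierM multiplierZ multiplier_over.

Lemma stable_multiplier c : C c -> multiplier c.
Proof.
move=> Cc y Ly; have [s [sB ->]] := coord_expansion basisB y.
rewrite mulr_sumr big_seq; apply: big_ind => // e /sB Be.
rewrite -scalerAr; apply: latticeZ => // e'.
apply: coord_closed (stableBC Cc Be) => //; first exact: val_ring0.
exact: val_ringD.
Qed.

(** Stability puts [C] inside the multiplier ring, and [C] spans [A], so denominators can be
    cleared. *)
Lemma multiplier_scaling y :
  exists c, [/\ c != 0, val_ring v c & multiplier (c *: y)].
Proof.
apply: (common_denominator (sub_0 multiplier_subalg)
  (@sub_D _ _ _ _ multiplier_subalg) multiplierZ).
have : lin_span setT C y by rewrite basisC.2.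
move=> [n [c [b [_ Cb ->]]]]; exists n, c, b; split=> // i.
exact: stable_multiplier.
Qed.

(* If y acts on every basis vector by one and the same scalar, then y is that
   scalar; z is an entry of the action witnessing the failure of this. *)
Lemma multiplier_bound y : ~ (exists f : F, y = f%:A) ->
  exists2 z, z != 0 &
    forall a b, multiplier (a *: (y - b%:A)) -> val_ring v (a * z).
Proof.
move=> nF; have E a b e e' : B e -> coord B e' (a *: (y - b%:A) * e) =
    a * (coord B e' (y * e) - b * (e == e')%:R).
  move=> Be; rewrite -scalerAl coordZ // mulrBl coordB // -scalerAl mul1r.
  by rewrite coordZ // (coord_basis basisB e' Be).
case: (pselect (exists e e', [/\ B e, e != e' & coord B e' (y * e) != 0])).
  (* An off-diagonal entry of [y] is unaffected by subtracting the scalar [b]. *)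
  move=> [e [e' [Be ee' z0]]]; exists (coord B e' (y * e)) => // a b.
  move=> /(_ _ (lattice_basis Be) e').
  by rewrite E // (negbTE ee') mulr0 subr0.
move=> ndiag.
case: (pselect (exists e e',
    [/\ B e, B e' & coord B e (y * e) != coord B e' (y * e')])).
  move=> [e [e' [Be Be' z0]]].
  (* In a difference of two diagonal entries the scalar [b] cancels. *)
  exists (coord B e (y * e) - coord B e' (y * e')).
    by rewrite subr_eq0.
  move=> a b Sab;
  have := val_ringB (Sab _ (lattice_basis Be) e)
                    (Sab _ (lattice_basis Be') e').
  rewrite !E // !eqxx -mulrBr; congr (val_ring v (_ * _)).
  by rewrite opprB addrA subrK.
move=> nconst; have [e0 Be0] := basis_neq0; case: nF.
exists (coord B e0 (y * e0)); set f := coord _ _ _.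
have yE e : B e -> y * e = f *: e.
  move=> Be; apply: (coord_inj basisB) => e'.
  rewrite coordZ // (coord_basis basisB e' Be).
  have [<-|ee'] := eqVneq e e'.
    rewrite mulr1; apply: contrapT => /eqP ne; apply: nconst; by exists e, e0.
  rewrite mulr0; apply: contrapT => /eqP ne; apply: ndiag; by exists e, e'.
(* Left multiplication by [y] is now scaling by [f] on [B]; evaluating at 1 gives [y] itself. *)
have [s [sB E1]] := coord_expansion basisB (1 : A).
rewrite -[LHS]mulr1 [in RHS]E1 [in LHS]E1 mulr_sumr scaler_sumr.
rewrite big_seq [RHS]big_seq.
apply: eq_bigr => e /sB Be.
by rewrite -scalerAr yE // scalerA mulrC -scalerA.
Qed.

End Multiplier.

(** * The decreasing chain of subalgebras *)

Section Chain.
Variables (F : fieldType) (G : ogroupType) (v : valuation F G) (A : algType F).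
Variables (R S : lying_over_subalg v A) (d : F).
Hypothesis Od : val_ring v d.
Implicit Types (x y : A) (n : nat).

(* The guard makes the chain start at R itself, which need not be contained in
   O_v + S. *)
Definition chain_set n : set A := [set x | R x /\
  ((0 < n)%N -> exists b y, [/\ val_ring v b, S y & x = b%:A + d ^+ n *: y])].

Fact chain1 n : chain_set n 1.
Proof.
split=> [|_]; first exact: sub_1.
exists 1, 0; split; [exact: val_ring1 | exact: sub_0 |].
by rewrite scaler0 addr0 scale1r.
Qed.

Fact chainB n x y : chain_set n x -> chain_set n y -> chain_set n (x - y).
Proof.
move=> [Rx Sx] [Ry Sy]; split=> [|n0]; first exact: sub_B.
have [a [r [Oa Sr ->]]] := Sx n0; have [b [t [Ob St ->]]] := Sy n0.
exists (a - b), (r - t); split; [exact: val_ringB | exact: sub_B |].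
by rewrite scalerBr scalerBl opprD addrACA.
Qed.

Fact chainM n x y : chain_set n x -> chain_set n y -> chain_set n (x * y).
Proof.
move=> [Rx Sx] [Ry Sy]; split=> [|n0]; first exact: sub_M.
have [a [r [Oa Sr ->]]] := Sx n0; have [b [t [Ob St ->]]] := Sy n0.
exists (a * b), (a *: t + b *: r + d ^+ n *: (r * t)); split.
- exact: val_ringM.
- apply: sub_D; first by apply: sub_D; exact: sub_Z.
  by apply: sub_Z; [exact: val_ringX | exact: sub_M].
rewrite mulrDl !mulrDr -!scalerAl -!scalerAr !mul1r !mulr1 !scalerDr !scalerA.
by rewrite -!addrA ![d ^+ n * _]mulrC [b * _]mulrC.
Qed.

Fact chainZ n a x : val_ring v a -> chain_set n x -> chain_set n (a *: x).
Proof.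
move=> Oa [Rx Sx]; split=> [|n0]; first exact: sub_Z.
have [b [r [Ob Sr ->]]] := Sx n0; exists (a * b), (a *: r).
split; [exact: val_ringM | exact: sub_Z |].
by rewrite scalerDr !scalerA [d ^+ n * _]mulrC.
Qed.

Fact chain_over n a : chain_set n a%:A <-> val_ring v a.
Proof.
split=> [[/sub_over//]|Oa]; apply: chainZ => //; exact: chain1.
Qed.

Definition chain_subalg n : lying_over_subalg v A := LyingOverSubalg
  (@chain1 n) (@chainB n) (@chainM n) (@chainZ n) (@chain_over n).

Lemma chain_subalg0 : gauge (chain_subalg 0) = gauge R.
Proof.
apply/funext => x; rewrite /gauge; case: ifP => // _; congr Fin.
apply/cut_eq/seteqP; split=> g [a va H]; exists a => //; first by case: H.
Qed.

Lemma chain_subset n : chain_set n.+1 `<=` chain_set n.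
Proof.
move=> x [Rx /(_ isT)[b [y [Ob Sy xE]]]]; split=> // _; exists b, (d *: y).
by split=> //; [exact: sub_Z | rewrite scalerA -exprSr].
Qed.

Lemma chain_neq n y : d != 0 -> R y -> S y ->
    (forall b, ~ S (d^-1 *: (y - b%:A))) ->
  chain_set n (d ^+ n *: y) /\ ~ chain_set n.+1 (d ^+ n *: y).
Proof.
move=> d0 Ry Sy nS; have Odn := val_ringX n Od; split.
  split=> [|_]; first exact: sub_Z.
  by exists 0, y; split=> //; [exact: val_ring0 | rewrite scale0r add0r].
(* Dividing d^n y = b + d^(n+1) z by d^n gives y - b/d^n = dz. The scalar b/d^n may leave [O_v],
   which is why [nS] ranges over all of F. *)
move=> [_ /(_ isT)[b [z [_ Sz E]]]]; apply: (nS (b / d ^+ n)).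
have dn0 : d ^+ n != 0 by exact: expf_neq0.
suff -> : y - (b / d ^+ n)%:A = d *: z by rewrite scalerA mulVf // scale1r.
apply: (scalerI dn0); rewrite scalerBr !scalerA E mulrCA divff // mulr1.
by rewrite addrC addKr exprSr.
Qed.

End Chain.

(** * From subalgebras to chains of quasi-valuations *)

Lemma nonscalarZ (F : fieldType) (A : algType F) (c : F) (x : A) : c != 0 ->
  ~ (exists f : F, x = f%:A) -> ~ (exists f : F, c *: x = f%:A).
Proof.
move=> c0 xF [f E]; apply: xF; exists (c^-1 * f).
by rewrite -scalerA -E scalerA mulVf // scale1r.
Qed.

(** Serves both claims, with [T] equal to [A] or to RF; having [R] inside [T] keeps the elements
    separating successive members in the domain. *)
Lemma gauge_chain (F : fieldType) (G : ogroupType) (v : valuation F G)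
    (A : algType F) (R : lying_over_subalg v A) (T : set A) (y : A) :
  nontrivial_valuation v -> (exists B : set A, stable_basis v B) ->
  R y -> ~ (exists f : F, y = f%:A) -> sub_set R `<=` T ->
  exists w : nat -> A -> adjoin_infty (cut_monoid G),
    w 0 = gauge R /\ decreasing_qv_chain v T (@cut_embed G) w.
Proof.
move=> nontriv [B [basisB [C basisC stableBC]]] Ry yF RT.
pose S := multiplier_subalg v basisB.
(* As [c] is in [O_v], the multiple [c *: y] lies in [S] without leaving [R]. *)
have [c [c0 Oc Sy]] := multiplier_scaling basisB basisC stableBC y.
have cyF := nonscalarZ c0 yF.
have [z z0 Sz] := multiplier_bound v basisB cyF.
have [d [d0 Od nd]] := exists_large_val nontriv z0.
have nS b : ~ S (d^-1 *: (c *: y - b%:A)).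
  by move=> /Sz; rewrite mulrC.
exists (fun n => gauge (chain_subalg R S Od n)); split.
  exact: chain_subalg0.
split=> n; last split.
- split; last by split; [exact: cut_embed_embedding | exact: gauge_scalar].
  have [w0 wM wD] := gauge_qv (chain_subalg R S Od n).
  by split=> // x x' _ _; [exact: wM | exact: wD].
- by move=> x _; apply: gauge_le; exact: chain_subset.
have Rcy : R (c *: y) by exact: sub_Z.
have [Rn nRn] := chain_neq (S := S) Od n d0 Rcy Sy nS.
exists (d ^+ n *: (c *: y)); first by apply: RT; case: Rn.
exact: gauge_neq.
Qed.

Theorem corollary3p20 (F : fieldType) (G : ogroupType) (v : valuation F G)
    (nontriv_v : nontrivial_valuation v)
    (A : algType F)
    (A_neq_F : [set a%:A | a in [set: F]] <> [set: A])
    (stable_A : exists B : set A, stable_basis v B) :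
  (exists (M : omonoidType) (e : G -> M) (w : nat -> A -> adjoin_infty M),
     decreasing_qv_chain v [set: A] e w) /\
  (forall R : lying_over_subalg v A,
     sub_set R <> [set a%:A | a in val_ring v] ->
     exists (M : omonoidType) (e : cut_monoid G -> M)
            (w : nat -> A -> adjoin_infty M),
       [/\ omonoid_embedding e,
           decreasing_qv_chain v (lin_span [set: F] (sub_set R))
             (e \o @cut_embed G) w
         & forall y, lin_span [set: F] (sub_set R) y ->
             w 0%N y = inf_map e (filter_qv R y)]).
Proof.
split.
  have [y yF] : exists y : A, ~ exists f : F, y = f%:A.
    apply: contrapT => nex; apply: A_neq_F; apply/seteqP; split=> // y _.
    apply: contrapT => ny; apply: nex; exists y => -[f yE]; apply: ny.
    by exists f.
  have [B [basisB [C basisC stableBC]]] := stable_A.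
  have [c [c0 Oc Sy]] := multiplier_scaling basisB basisC stableBC y.
  (* The gauge of the multiplier ring is a quasi-valuation on all of [A], so [T] can be
     everything. *)
  have [w [_ wP]] := @gauge_chain _ _ _ _ (multiplier_subalg v basisB) setT
    (c *: y) nontriv_v stable_A Sy (nonscalarZ c0 yF) (fun _ _ => I).
  by exists (cut_monoid G), (@cut_embed G), w.
move=> R R_neq.
have [y Ry yF] : exists2 y, R y & ~ exists f : F, y = f%:A.
  apply: contrapT => nex; apply: R_neq.
  apply/seteqP; split=> [y Ry|_ [a Oa <-]].
    apply: contrapT => ny; apply: nex; exists y => // -[f yE]; apply: ny.
    by exists f => //; apply/(sub_over R); rewrite -yE.
  exact/sub_over.
have RT : sub_set R `<=` lin_span [set: F] (sub_set R).
  move=> x Rx; exists 1%N, (fun=> 1), (fun=> x).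
  by split=> //; rewrite big_ord1 scale1r.
have [w [w0 wP]] := gauge_chain nontriv_v stable_A Ry yF RT.
exists (cut_monoid G), id, w; split=> // y' Ry'.
by rewrite w0 filter_qv_gauge //; case: (gauge R y').
Qed.
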